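(* None of the following seven properties holds in general for positive definite matrices over finite definite fields; that is, for each $i\in\{1,\dots,7\}$ there exist a finite definite field $\mathbb{F}$, a positive integer $n$, and a positive definite matrix $A\in M_n(\mathbb{F})$ (and, for $i\in\{5,6,7\}$, also a positive definite matrix $B\in M_n(\mathbb{F})$) for which property ($i$) fails: (1) every eigenvalue of $A$ in $\mathbb{F}$ is positive; (2) the form $\langle x,y\rangle=y^TAx$ on $\mathbb{F}^n$ is an inner product, in the sense that in particular $\langle x,x\rangle$ is non-zero and positive for all non-zero $x\in\mathbb{F}^n$; (3) all principal submatrices of $A$ are positive definite; (4) $A^{-1}$ is positive definite; (5) $A+B$ is positive definite; (6) $ABA$ and $BAB$ are positive definite; (7) the Hadamard product $A\circ B$ is positive definite and the Frobenius inner product $A:B=\sum_{i,j}a_{ij}b_{ij}$ is positive.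
   Context: An element $x$ of a field $\mathbb{F}$ is called positive if $x=\mu^2$ for some non-zero $\mu\in\mathbb{F}$; then $\mu$ is a square root of $x$, and it is a positive square root if $\mu$ is itself positive. A field is a definite field if each of its positive elements has a positive square root in it; a finite definite field is a definite field that is finite. $M_n(\mathbb{F})$ is the set of $n\times n$ matrices over $\mathbb{F}$. A symmetric matrix $A\in M_n(\mathbb{F})$ over a definite field $\mathbb{F}$ has a Cholesky decomposition if $A=LL^T$ for some lower triangular $L\in M_n(\mathbb{F})$ all of whose diagonal entries are positive. A symmetric $n\times n$ matrix over a definite field is positive definite if it has a Cholesky decomposition. A principal submatrix is obtained by deleting rows and columns with the same index set. The Hadamard product is the entrywise product. *)

(* Defs.v *)
From mathcomp Require Import all_boot all_order all_algebra.

Set Implicit Arguments.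
Unset Strict Implicit.
Unset Printing Implicit Defensive.

Import GRing.Theory.
Local Open Scope ring_scope.

Definition positive (F : fieldType) (x : F) : Prop :=
  exists2 mu : F, mu != 0 & x = mu ^+ 2.

(* Characteristic 2 is not excluded. *)
Definition definite_field (F : fieldType) : Prop :=
  forall x : F, positive x -> exists2 mu : F, positive mu & x = mu ^+ 2.

(* [is_trig_mx] is lower triangularity. *)
Definition has_cholesky (F : fieldType) (n : nat) (A : 'M[F]_n) : Prop :=
  exists L : 'M[F]_n,
    [/\ is_trig_mx L, forall i, positive (L i i) & A = L *m L^T].

Definition posdef (F : fieldType) (n : nat) (A : 'M[F]_n) : Prop :=
  A^T = A /\ has_cholesky A.

(* So [invmx A] is the genuine inverse of a positive definite [A], and not
   the default value taken by [invmx] on singular matrices. *)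
Lemma posdef_unitmx (F : fieldType) (n : nat) (A : 'M[F]_n) :
  posdef A -> A \in unitmx.
Proof.
move=> [_ [L [Ltrig Lpos ->]]].
rewrite unitmxE det_mulmx det_tr -expr2 unitrX // unitfE (det_trig Ltrig).
by apply/prodf_neq0 => i _; have [mu mu0 ->] := Lpos i; rewrite expf_neq0.
Qed.

Definition mxform (F : fieldType) (n : nat) (A : 'M[F]_n) (x y : 'cV[F]_n) : F :=
  (y^T *m A *m x) 0 0.

(* The rows and columns with index in [D] are deleted. The remaining ones keep
   their order, since [enum_val] is increasing on sets of ordinals; the order
   matters because [posdef] is not invariant under permutation of the indices.
   Deleting everything gives the 0 x 0 matrix, which is [posdef]. *)
Definition principal_submx (F : fieldType) (n : nat) (A : 'M[F]_n)
    (D : {set 'I_n}) : 'M[F]_#|~: D| :=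
  mxsub enum_val enum_val A.

Definition hadamard (F : fieldType) (n : nat) (A B : 'M[F]_n) : 'M[F]_n :=
  map2_mx *%R A B.

Definition frobenius (F : fieldType) (n : nat) (A B : 'M[F]_n) : F :=
  \sum_i \sum_j A i j * B i j.

(* Main.v *)
Require Import Defs.
From mathcomp Require Import all_boot all_order all_algebra.
Import GRing.Theory.
Local Open Scope ring_scope.

(** One matrix over the field with three elements refutes all seven
    properties.  In F_3 the only non-zero square is 1, and 1 is the square of
    1, so the field is definite and positive means equal to 1.  Take the
    positive definite matrix (counterexample below, L is cholesky_factor)
[[
        1  1  1             1  0  0
    A = 1 -1  1  = L L^T,   L = 1  1  0   (here 1 + 1 = -1).
        1  1 -1             1  0  1
]]
    The entry -1 on the diagonal is a value of the quadratic form and a 1 x 1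
    principal submatrix, and -1 is also an eigenvalue, with eigenvector
    (1, -1, -1); this settles (1), (2) and (3).

    The top left entry of a positive definite matrix is the square of the top
    left entry of its Cholesky factor, hence positive (posdef_corner).  That
    entry is 0 for the inverse of A, and -1 for A + A and for A A A, so (4), (5)
    and (6) fail, the last two with B = A.  Finally all entries of A are 1 or
    -1, so the Frobenius product of A with itself is a sum of nine ones, which
    is 0: this refutes (7). *)

Lemma positive_neq0 (F : fieldType) (x : F) : positive x -> x != 0.
Proof. by case=> mu mu0 ->; rewrite expf_neq0. Qed.

(** Row 0 of a lower triangular L is supported on column 0, so the corner of
    L L^T is a single square.  The index is any i of value 0 instead of ord0,
    since the size of a principal submatrix is not syntactically a successor. *)
Lemma posdef_corner (F : fieldType) (n : nat) (A : 'M[F]_n) (i : 'I_n) :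
  i = 0%N :> nat -> posdef A -> positive (A i i).
Proof.
move=> i0 [_ [L [/is_trig_mxP Ltrig Lpos ->]]].
exists (L i i); first exact: positive_neq0.
rewrite mxE (bigD1 i) //= big1 ?addr0 => [|k neq_ki]; first by rewrite mxE expr2.
rewrite Ltrig ?mul0r // i0 lt0n; apply: contra neq_ki => /eqP k0.
by apply/eqP/val_inj; rewrite /= k0 i0.
Qed.

Lemma mxform_delta (F : fieldType) (n : nat) (A : 'M[F]_n) (i : 'I_n) :
  mxform A (delta_mx i 0) (delta_mx i 0) = A i i.
Proof. by rewrite /mxform trmx_delta -rowE -colE !mxE. Qed.

Lemma posdef_submx1 (F : fieldType) (n : nat) (A : 'M[F]_n) (i : 'I_n) :
  posdef (principal_submx A (~: [set i])) -> positive (A i i).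
Proof.
have card_gt0 : (0 < #|~: ~: [set i]|)%N by rewrite setCK cards1.
move=> /(@posdef_corner _ _ _ (Ordinal card_gt0) erefl); rewrite mxE.
by have := enum_valP (Ordinal card_gt0); rewrite !inE negbK => /eqP ->.
Qed.

(** The elements of F_3 are ordinals below 3, so equality of closed terms is
    decided by computation; the matrix identities below use this too, after
    the sums, which do not reduce by themselves, have been expanded. *)
Lemma positive_F3 (x : 'F_3) : positive x -> x = 1.
Proof.
by case=> -[[|[|[|//]]] mu_lt] mu0 ->; apply/eqP.
Qed.

Lemma definite_F3 : definite_field 'F_3.
Proof.
move=> x /positive_F3 ->; exists 1; last by rewrite expr1n.
by exists 1; rewrite ?oner_neq0 ?expr1n.
Qed.

Lemma positive1 (F : fieldType) : positive (1 : F).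
Proof. by exists 1; rewrite ?oner_neq0 ?expr1n. Qed.

Lemma not_positiveN1 : ~ positive (-1 : 'F_3).
Proof. by move=> /positive_F3 /eqP. Qed.

Lemma not_positive0 (F : fieldType) : ~ positive (0 : F).
Proof. by move=> /positive_neq0 /eqP. Qed.

Definition cholesky_factor : 'M['F_3]_3 := \matrix_(i, j) ((j == i) || (j == 0))%:R.

Definition counterexample : 'M['F_3]_3 :=
  \matrix_(i, j) (if (i == j) && (i != 0) then -1 else 1).

Lemma posdef_counterexample : posdef counterexample.
Proof.
split; first by apply/matrixP => i j; rewrite !mxE eq_sym; case: eqVneq => [->|].
exists cholesky_factor; split.
- apply/is_trig_mxP => i j lt_ij; rewrite mxE.
  by case: i j lt_ij => [[|[|[|//]]] ?] [[|[|[|//]]] ?].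
- by move=> i; rewrite mxE eqxx; apply: positive1.
apply/matrixP => i j; rewrite !mxE !big_ord_recl big_ord0 !mxE.
by case: i j => [[|[|[|//]]] ?] [[|[|[|//]]] ?]; apply/eqP.
Qed.

Lemma eigenvalue_counterexample : eigenvalue counterexample (-1).
Proof.
apply/eigenvalueP; exists (\row_j (if j == 0 then 1 else -1)).
  apply/rowP => j; rewrite !mxE !big_ord_recl big_ord0 !mxE.
  by case: j => [[|[|[|//]]] ?]; apply/eqP.
by apply/eqP => /rowP/(_ 0); rewrite !mxE => /eqP.
Qed.

(** The first column of the inverse solves A x = e_0, and x = (0, -1, -1)
    does. *)
Lemma invmx_counterexample_corner : invmx counterexample 0 0 = 0.
Proof.
pose x : 'cV['F_3]_3 := \col_i (if i == 0 then 0 else -1).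
have Ax : counterexample *m x = delta_mx 0 0.
  apply/colP => i; rewrite !mxE !big_ord_recl big_ord0 !mxE.
  by case: i => [[|[|[|//]]] ?]; apply/eqP.
have : invmx counterexample *m delta_mx 0 0 = x.
  by rewrite -Ax mulKmx //; apply: posdef_unitmx posdef_counterexample.
by rewrite -colE => /colP/(_ 0); rewrite !mxE.
Qed.

Lemma cube_counterexample_corner : (counterexample *m counterexample *m counterexample) 0 0 = -1.
Proof.
by rewrite !(mxE, big_ord_recl, big_ord0); apply/eqP.
Qed.

Lemma frobenius_counterexample : frobenius counterexample counterexample = 0.
Proof.
by rewrite /frobenius !(mxE, big_ord_recl, big_ord0); apply/eqP.
Qed.

Theorem theorem6 :
  (exists (F : finFieldType) (n : nat) (A : 'M[F]_n),
     [/\ definite_field F, (0 < n)%N, posdef A &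
       ~ (forall a : F, eigenvalue A a -> positive a)]) /\
  (exists (F : finFieldType) (n : nat) (A : 'M[F]_n),
     [/\ definite_field F, (0 < n)%N, posdef A &
       ~ (forall x : 'cV[F]_n, x != 0 ->
            mxform A x x != 0 /\ positive (mxform A x x))]) /\
  (exists (F : finFieldType) (n : nat) (A : 'M[F]_n),
     [/\ definite_field F, (0 < n)%N, posdef A &
       ~ (forall D : {set 'I_n}, posdef (principal_submx A D))]) /\
  (exists (F : finFieldType) (n : nat) (A : 'M[F]_n),
     [/\ definite_field F, (0 < n)%N, posdef A & ~ posdef (invmx A)]) /\
  (exists (F : finFieldType) (n : nat) (A B : 'M[F]_n),
     [/\ definite_field F, (0 < n)%N, posdef A, posdef B & ~ posdef (A + B)]) /\
  (exists (F : finFieldType) (n : nat) (A B : 'M[F]_n),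
     [/\ definite_field F, (0 < n)%N, posdef A, posdef B &
       ~ (posdef (A *m B *m A) /\ posdef (B *m A *m B))]) /\
  (exists (F : finFieldType) (n : nat) (A B : 'M[F]_n),
     [/\ definite_field F, (0 < n)%N, posdef A, posdef B &
       ~ (posdef (hadamard A B) /\ positive (frobenius A B))]).
Proof.
have defF := definite_F3; have pdA := posdef_counterexample.
have A11 : counterexample 1 1 = -1 by rewrite mxE.
split; [|split; [|split; [|split; [|split; [|split]]]]];
  do [exists 'F_3, 3, counterexample, counterexample | exists 'F_3, 3, counterexample]; split=> //.
- by move=> /(_ _ eigenvalue_counterexample); apply: not_positiveN1.
- move=> /(_ (delta_mx 1 0)); rewrite mxform_delta A11 => -[|_].
    by apply/eqP => /colP/(_ 1); rewrite !mxE => /eqP.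
  exact: not_positiveN1.
- by move=> /(_ (~: [set 1])) /posdef_submx1; rewrite A11; apply: not_positiveN1.
- move=> /(posdef_corner _ _ _ 0 erefl); rewrite invmx_counterexample_corner.
  exact: not_positive0.
- move=> /(posdef_corner _ _ _ 0 erefl).
  have -> : (counterexample + counterexample) 0 0 = -1 by rewrite !mxE; apply/eqP.
  exact: not_positiveN1.
- move=> [/(posdef_corner _ _ _ 0 erefl) + _]; rewrite cube_counterexample_corner.
  exact: not_positiveN1.
- by move=> [_]; rewrite frobenius_counterexample; apply: not_positive0.
Qed.
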